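(* Let $h_{00},h_{11},h_{22},h_{33}>0$ and consider the system $\mathrm{(SL)}$ below with $g_{ii}(0)=h_{ii}$. Then the solution exists for all $t\ge0$ and, as $t\to\infty$: $g_{00}\to0$, $g_{11}\to0$, $g_{22}\to\infty$, $g_{33}\to\infty$, and $g_{33}-g_{22}\to 0$.
   Context: Let $\det h = h_{00}h_{11}h_{22}h_{33}$, $\beta = \frac{1}{6(\det h)^2}$, and $p(x,y,z) = x^4 - x^3(y+z) + x^2yz + x(-y^3+y^2z+yz^2-z^3) + y^4 - y^3z - yz^3 + z^4$, $q(x,y,z) = 5x^4 - 3x^3(y+z) + x^2yz + x(y^3-y^2z-yz^2+z^3) - 3y^4 + 3y^3z + 3yz^3 - 3z^4$. System (SL): $\dot g_{00} = -\beta\,p(-g_{11},g_{22},g_{33})\,g_{00}^3$, $\dot g_{11} = -\beta\,q(-g_{11},g_{22},g_{33})\,g_{00}^2g_{11}$, $\dot g_{22} = -\beta\,q(g_{22},-g_{11},g_{33})\,g_{00}^2g_{22}$, $\dot g_{33} = -\beta\,q(g_{33},-g_{11},g_{22})\,g_{00}^2g_{33}$. This is Bach flow $\partial_t g=B$, $g(0)=h$, on $\mathbb{R}\times\widetilde{SL}(2,\mathbb{R})$ in a diagonalizing basis: a left-invariant frame $\{\partial_0,e_1,e_2,e_3\}$ with $[e_i,e_j]=\sum\varepsilon_{ijl}E^{lk}e_k$, $E=\mathrm{diag}(-1,1,1)$, and $g=\mathrm{diag}(g_{00},g_{11},g_{22},g_{33})$; $B$ is the Bach tensor. Along the flow $g_{00}g_{11}g_{22}g_{33}=\det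 h$. *)

(* Defs.v *)
From Stdlib Require Import Reals Lra.
Open Scope R_scope.

Definition p_poly (x y z : R) : R :=
  x^4 - x^3*(y+z) + x^2*y*z + x*(-y^3 + y^2*z + y*z^2 - z^3)
  + y^4 - y^3*z - y*z^3 + z^4.

Definition q_poly (x y z : R) : R :=
  5*x^4 - 3*x^3*(y+z) + x^2*y*z + x*(y^3 - y^2*z - y*z^2 + z^3)
  - 3*y^4 + 3*y^3*z + 3*y*z^3 - 3*z^4.

(* beta = 1 / (6 (det h)^2), det h = h00 h11 h22 h33 *)
Definition beta_of (h0 h1 h2 h3 : R) : R := / (6 * (h0*h1*h2*h3)^2).

Definition right_cont_at0 (f : R -> R) : Prop :=
  forall eps, eps > 0 -> exists delta, delta > 0 /\
    forall t, 0 <= t < delta -> Rabs (f t - f 0) < eps.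

Definition SL_solution (h0 h1 h2 h3 : R) (g0 g1 g2 g3 : R -> R) : Prop :=
  let b := beta_of h0 h1 h2 h3 in
  g0 0 = h0 /\ g1 0 = h1 /\ g2 0 = h2 /\ g3 0 = h3 /\
  right_cont_at0 g0 /\ right_cont_at0 g1 /\
  right_cont_at0 g2 /\ right_cont_at0 g3 /\
  forall t, 0 < t ->
    derivable_pt_lim g0 t
      (- b * p_poly (- g1 t) (g2 t) (g3 t) * (g0 t)^3) /\
    derivable_pt_lim g1 t
      (- b * q_poly (- g1 t) (g2 t) (g3 t) * (g0 t)^2 * g1 t) /\
    derivable_pt_lim g2 t
      (- b * q_poly (g2 t) (- g1 t) (g3 t) * (g0 t)^2 * g2 t) /\
    derivable_pt_lim g3 t
      (- b * q_poly (g3 t) (- g1 t) (g2 t) * (g0 t)^2 * g3 t).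

Definition tends_to_at_infty (f : R -> R) (l : R) : Prop :=
  forall eps, eps > 0 -> exists T, forall t, t >= T -> Rabs (f t - l) < eps.

Definition tends_to_pinfty (f : R -> R) : Prop :=
  forall M, exists T, forall t, t >= T -> f t > M.

(* Main.v *)
Require Import Defs.
From Stdlib Require Import Reals Lra Psatz.
From Coquelicot Require Import Coquelicot.
Open Scope R_scope.

(* Write x, y, z for g11, g22, g33; by symmetry assume h22 <= h33. The gap z - y satisfies
   a linear equation, so y <= z is preserved. In terms of x, y and z - y, each of
   p(-x,y,z), q(y,-x,z) and the polynomials giving the logarithmic derivatives of z/y,
   xz and x^3 y^5 has coefficients of one sign: g00 decreases, y increases, z/y and xz
   decrease, and x^3 y^5 increases. Since beta g00^2 = 1 / (6 x^2 y^2 z^2), this gives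
   (y^2)' >= y / (3z) >= h22 / (3 h33), so y and z tend to infinity and x <= C / z tends
   to 0; moreover (xyz)^3 >= x^3 y^6 >= c y, so g00 tends to 0. Once x <= min(1, y) the
   logarithmic derivative of z - y is at most -1. The same monotone quantities bound the
   solution on every bounded time interval, the last ingredient being z' <= C z, whence
   global existence by truncating the field outside a box growing exponentially in time. *)

(** * Continuous functions and a global Picard theorem *)

Definition cont (f : R -> R) : Prop := forall t, continuous f t.

Lemma cont_pt (f : R -> R) (t : R) : cont f -> continuity_pt f t.
Proof. intros Hf. apply continuity_pt_filterlim, Hf. Qed.

Lemma cont_const (c : R) : cont (fun _ => c).
Proof. intros t. apply continuous_const. Qed.

Lemma cont_opp (f : R -> R) : cont f -> cont (fun t => - f t).
Proof. intros Hf t. apply (continuous_opp (V := R_NormedModule)), Hf. Qed.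

Lemma cont_plus (f g : R -> R) : cont f -> cont g -> cont (fun t => f t + g t).
Proof. intros Hf Hg t. apply (continuous_plus (V := R_NormedModule)); auto. Qed.

Lemma cont_minus (f g : R -> R) : cont f -> cont g -> cont (fun t => f t - g t).
Proof. intros Hf Hg t. apply (continuous_minus (V := R_NormedModule)); auto. Qed.

Lemma cont_mult (f g : R -> R) : cont f -> cont g -> cont (fun t => f t * g t).
Proof. intros Hf Hg t. apply (continuous_mult (K := R_AbsRing)); auto. Qed.

Lemma cont_pow (f : R -> R) (n : nat) : cont f -> cont (fun t => f t ^ n).
Proof.
  intros Hf. induction n as [|n IH]; [exact (cont_const 1)|].
  apply (cont_mult f (fun t => f t ^ n)); auto.
Qed.

Lemma cont_comp (f g : R -> R) : cont f -> cont g -> cont (fun t => g (f t)).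
Proof. intros Hf Hg t. apply (continuous_comp f g); auto. Qed.

Lemma cont_id : cont (fun t => t).
Proof. intros t. apply continuous_id. Qed.

Lemma cont_lipschitz1 (f : R -> R) :
  (forall s t, Rabs (f s - f t) <= Rabs (s - t)) -> cont f.
Proof.
  intros Hf t. apply continuity_pt_filterlim.
  intros eps Heps. exists eps. split; [exact Heps|].
  intros s [_ Hs]. apply Rle_lt_trans with (2 := Hs), Hf.
Qed.

Lemma cont_exp : cont exp.
Proof. intros t. apply continuity_pt_filterlim, derivable_continuous_pt, derivable_pt_exp. Qed.

Lemma cont_Rabs (f : R -> R) : cont f -> cont (fun t => Rabs (f t)).
Proof. intros Hf. apply (cont_comp f Rabs Hf), cont_lipschitz1. intros; apply Rabs_triang_inv2. Qed.

Ltac cont_auto :=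
  lazymatch goal with
  | |- cont (fun _ => ?c) => apply (cont_const c)
  | |- cont (fun t => t) => apply cont_id
  | |- cont (fun t => @?f t + @?g t) => apply (cont_plus f g); cont_auto
  | |- cont (fun t => @?f t - @?g t) => apply (cont_minus f g); cont_auto
  | |- cont (fun t => @?f t * @?g t) => apply (cont_mult f g); cont_auto
  | |- cont (fun t => - @?f t) => apply (cont_opp f); cont_auto
  | |- cont (fun t => @?f t ^ ?n) => apply (cont_pow f n); cont_auto
  | |- _ => assumption
  end.

Lemma cont_exp_linear (c : R) : cont (fun t => exp (c * t)).
Proof.
  apply (cont_comp (fun t => c * t) exp); [|apply cont_exp].
  apply cont_mult; [apply cont_const|apply cont_id].
Qed.

Lemma cont_bounded (f : R -> R) (a b : R) :
  cont f -> exists M, 0 <= M /\ forall t, a <= t <= b -> Rabs (f t) <= M.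
Proof.
  intros Hf. destruct (Rle_dec a b) as [Hab|Hab].
  - destruct (continuity_ab_maj (fun t => Rabs (f t)) a b Hab) as [m [Hm _]].
    + intros c _. apply cont_pt.
      apply cont_Rabs, Hf.
    + exists (Rabs (f m)). split; [apply Rabs_pos|exact Hm].
  - exists 0. split; [lra|]. intros t Ht. lra.
Qed.

Lemma Rmax_0_lipschitz (s t : R) : Rabs (Rmax s 0 - Rmax t 0) <= Rabs (s - t).
Proof. unfold Rmax, Rabs. repeat destruct Rle_dec; repeat destruct Rcase_abs; lra. Qed.

Lemma cont_Rmax_0 : cont (fun t => Rmax t 0).
Proof. apply cont_lipschitz1, Rmax_0_lipschitz. Qed.

Lemma cont_Rmax (f g : R -> R) : cont f -> cont g -> cont (fun t => Rmax (f t) (g t)).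
Proof.
  intros Hf Hg.
  assert (H : cont (fun t => g t + Rmax (f t - g t) 0)).
  { apply cont_plus; [exact Hg|].
    apply (cont_comp (fun t => f t - g t) (fun s => Rmax s 0)); [cont_auto|apply cont_Rmax_0]. }
  intros t. apply (continuous_ext (fun t => g t + Rmax (f t - g t) 0)); [|apply H].
  intros s. unfold Rmax. repeat destruct Rle_dec; lra.
Qed.

Lemma cont_Rmin (f g : R -> R) : cont f -> cont g -> cont (fun t => Rmin (f t) (g t)).
Proof.
  intros Hf Hg t.
  apply (continuous_ext (fun t => - Rmax (- f t) (- g t))).
  - intros s. unfold Rmin, Rmax. repeat destruct Rle_dec; lra.
  - apply cont_opp, cont_Rmax; apply cont_opp; assumption.
Qed.

(** The state space [I -> R] gets no topology here: continuity is tested along continuous curves,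
    and the supremum norm enters through a common bound [M] for all coordinate differences. The
    constants are uniform in the state, which rules out blow-up. *)
Definition regular_field {I : Type} (F : R -> (I -> R) -> I -> R) : Prop :=
  (forall u : R -> I -> R, (forall j, cont (fun s => u s j)) ->
     forall i, cont (fun s => F s (u s) i)) /\
  (forall T, exists B L, 0 <= B /\ 0 <= L /\ forall t, 0 <= t <= T ->
     forall i u, Rabs (F t u i) <= B /\
     forall v M, (forall j, Rabs (u j - v j) <= M) ->
       Rabs (F t u i - F t v i) <= L * M).

(** The upper limit [Rmax t 0] freezes every iterate at its initial value for negative times, so
    that iterates are continuous on the whole line. *)
Fixpoint picard {I : Type} (F : R -> (I -> R) -> I -> R) (u0 : I -> R) (n : nat)
  (t : R) (i : I) : R :=
  match n with
  | O => u0 i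
  | S m => u0 i + RInt (fun s => F s (picard F u0 m s) i) 0 (Rmax t 0)
  end.

Lemma cont_ex_RInt (f : R -> R) (a b : R) : cont f -> ex_RInt f a b.
Proof. intros Hf. apply (ex_RInt_continuous (V := R_CompleteNormedModule)). intros; apply Hf. Qed.

Lemma is_derive_primitive (f : R -> R) (t : R) :
  cont f -> is_derive (fun b => RInt f 0 b) t (f t).
Proof.
  intros Hf. apply (is_derive_RInt (V := R_NormedModule) f (fun b => RInt f 0 b) 0).
  - apply filter_forall. intros b.
    apply (RInt_correct (V := R_CompleteNormedModule)), cont_ex_RInt, Hf.
  - apply Hf.
Qed.

Lemma cont_primitive (f : R -> R) : cont f -> cont (fun b => RInt f 0 b).
Proof.
  intros Hf t. apply (ex_derive_continuous (V := R_NormedModule)).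
  exists (f t). apply is_derive_primitive, Hf.
Qed.

Lemma cont_primitive_Rmax (f : R -> R) (c : R) :
  cont f -> cont (fun t => c + RInt f 0 (Rmax t 0)).
Proof.
  intros Hf. apply cont_plus; [apply cont_const|].
  apply (cont_comp (fun t => Rmax t 0) (fun b => RInt f 0 b));
    [apply cont_Rmax_0|apply cont_primitive, Hf].
Qed.

Lemma Rabs_RInt_minus_le (f g h : R -> R) (t : R) :
  0 <= t -> cont f -> cont g -> cont h ->
  (forall s, 0 <= s <= t -> Rabs (f s - g s) <= h s) ->
  Rabs (RInt f 0 t - RInt g 0 t) <= RInt h 0 t.
Proof.
  intros Ht Hf Hg Hh H.
  assert (E : RInt (fun s => f s - g s) 0 t = RInt f 0 t - RInt g 0 t)
    by (apply (RInt_minus (V := R_CompleteNormedModule)); apply cont_ex_RInt; assumption).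
  rewrite <- E.
  assert (Hfg : cont (fun s => f s - g s)) by (apply cont_minus; assumption).
  eapply Rle_trans; [apply abs_RInt_le; [exact Ht|apply cont_ex_RInt, Hfg]|].
  apply RInt_le; [exact Ht| |apply cont_ex_RInt, Hh|].
  - apply cont_ex_RInt, cont_Rabs, Hfg.
  - intros s Hs. apply H. lra.
Qed.

Lemma picard_cont {I : Type} (F : R -> (I -> R) -> I -> R) (u0 : I -> R) (n : nat) (i : I) :
  regular_field F -> cont (fun t => picard F u0 n t i).
Proof.
  intros [HF _]. revert i. induction n as [|n IH]; intros i; [exact (cont_const (u0 i))|].
  apply cont_primitive_Rmax, (HF (picard F u0 n)), IH.
Qed.

Lemma RInt_exp_weight (L A t : R) :
  RInt (fun s => L * (A * exp (2 * L * s))) 0 t = A / 2 * (exp (2 * L * t) - 1).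
Proof.
  apply is_RInt_unique.
  replace (A / 2 * (exp (2 * L * t) - 1)) with
    (minus (A / 2 * exp (2 * L * t)) (A / 2 * exp (2 * L * 0))).
  - apply (is_RInt_derive (fun s => A / 2 * exp (2 * L * s))).
    + intros s _. auto_derive; [trivial|field].
    + intros s _.
      assert (C : cont (fun s => L * (A * exp (2 * L * s)))).
      { apply cont_mult; [apply cont_const|]. apply cont_mult; [apply cont_const|].
        apply cont_exp_linear. }
      apply C.
  - unfold minus, plus, opp; simpl. rewrite Rmult_0_r, exp_0. ring.
Qed.

(* The weight exp (2 L t) makes the Picard operator a contraction of ratio 1/2. *)
Lemma picard_step {I : Type} (F : R -> (I -> R) -> I -> R) (u0 : I -> R) (T : R) :
  regular_field F -> exists A, 0 <= A /\ forall n t i, 0 <= t <= T ->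
    Rabs (picard F u0 (S n) t i - picard F u0 n t i) <= A * (/ 2) ^ n.
Proof.
  intros HF. destruct HF as [HC HL]. assert (HF : regular_field F) by (split; assumption).
  destruct (HL T) as [B [L [HB [HL0 Hb]]]].
  (* The factor [B * T] bounds the first step, the integral of a field of size at most [B]; each
     further integration against the weight contributes 1/2. *)
  assert (W : forall n t i, 0 <= t <= T ->
    Rabs (picard F u0 (S n) t i - picard F u0 n t i)
      <= B * T * (/ 2) ^ n * exp (2 * L * t)).
  { induction n as [|n IH]; intros t i Ht.
    - simpl. rewrite Rmax_left by lra.
      replace (u0 i + _ - u0 i) with
        (RInt (fun s => F s (fun j => u0 j) i) 0 t - RInt (fun _ => 0) 0 t)
        by (rewrite (RInt_const (V := R_CompleteNormedModule)); unfold scal; simpl;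
            unfold mult; simpl; ring).
      apply Rle_trans with (RInt (fun _ => B) 0 t).
      + apply Rabs_RInt_minus_le; try lra; try apply cont_const.
        * apply (HC (fun _ j => u0 j)). intros j. apply cont_const.
        * intros s Hs. rewrite Rminus_0_r. apply Hb. lra.
      + rewrite (RInt_const (V := R_CompleteNormedModule)). unfold scal; simpl.
        unfold mult; simpl.
        assert (1 <= exp (2 * L * t)).
        { rewrite <- exp_0. destruct (Req_dec (2 * L * t) 0) as [->|]; [lra|].
          apply Rlt_le, exp_increasing. assert (0 <= L * t) by nra. lra. }
        assert (0 <= B * T) by nra. nra.
    - assert (E : forall m, picard F u0 (S m) t i
        = u0 i + RInt (fun s => F s (picard F u0 m s) i) 0 t)
        by (intros m; simpl; rewrite Rmax_left; lra).
      rewrite (E (S n)), (E n).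
      match goal with |- Rabs (u0 i + ?a - (u0 i + ?b)) <= _ =>
        replace (u0 i + a - (u0 i + b)) with (a - b) by ring end.
      apply Rle_trans with
        (RInt (fun s => L * (B * T * (/ 2) ^ n * exp (2 * L * s))) 0 t).
      + apply Rabs_RInt_minus_le; try lra.
        * apply (HC (picard F u0 (S n))). intros j. apply picard_cont, HF.
        * apply (HC (picard F u0 n)). intros j. apply picard_cont, HF.
        * apply cont_mult; [apply cont_const|]. apply cont_mult; [apply cont_const|].
          apply cont_exp_linear.
        * intros s Hs. apply Hb; [lra|]. intros j. apply IH. lra.
      + rewrite RInt_exp_weight.
        assert (0 <= B * T * (/ 2) ^ n).
        { apply Rmult_le_pos; [nra|]. apply pow_le. lra. }
        simpl. lra. }
  (* [Rmax T 0] keeps the constant nonnegative when [T] is negative and the range of times is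
     empty. *)
  exists (B * Rmax T 0 * exp (2 * L * Rmax T 0)).
  assert (HT : 0 <= Rmax T 0) by apply Rmax_r.
  split; [apply Rmult_le_pos; [nra|apply Rlt_le, exp_pos]|].
  intros n t i Ht. eapply Rle_trans; [apply W, Ht|].
  rewrite Rmax_left by lra.
  assert (exp (2 * L * t) <= exp (2 * L * T)).
  { destruct (Req_dec (2 * L * t) (2 * L * T)) as [->|]; [lra|].
    apply Rlt_le, exp_increasing. assert (L * t <= L * T) by nra. lra. }
  assert (0 <= B * T * (/ 2) ^ n).
  { apply Rmult_le_pos; [nra|]. apply pow_le. lra. }
  nra.
Qed.

(** Telescoping makes the sequence Cauchy with tail [2 * A * (/ 2) ^ n]. The limit is named by the
    total operator [Lim_seq], so the limit of the Picard iterates can be defined pointwise without a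
    choice. *)
Lemma geometric_steps_cv (a : nat -> R) (A : R) :
  (forall n, Rabs (a (S n) - a n) <= A * (/ 2) ^ n) ->
  forall n, Rabs (a n - real (Lim_seq a)) <= 2 * A * (/ 2) ^ n.
Proof.
  intros Ha.
  assert (D : forall k n, Rabs (a (n + k)%nat - a n) <= 2 * A * ((/ 2) ^ n - (/ 2) ^ (n + k))).
  { induction k as [|k IH]; intros n.
    - rewrite Nat.add_0_r. rewrite !Rminus_diag, Rabs_R0. lra.
    - replace (a (n + S k)%nat - a n) with
        ((a (S (n + k)) - a (n + k)%nat) + (a (n + k)%nat - a n))
        by (rewrite <- plus_n_Sm; ring).
      eapply Rle_trans; [apply Rabs_triang|].
      specialize (IH n). specialize (Ha (n + k)%nat).
      replace ((/ 2) ^ (n + S k)) with (/ 2 * (/ 2) ^ (n + k))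
        by (rewrite <- plus_n_Sm; reflexivity).
      lra. }
  assert (A0 : 0 <= A).
  { specialize (Ha 0%nat). simpl in Ha. pose proof (Rabs_pos (a 1%nat - a 0%nat)). lra. }
  assert (P : forall n, 0 < (/ 2) ^ n) by (intros; apply pow_lt; lra).
  assert (D' : forall n k, Rabs (a (n + k)%nat - a n) <= 2 * A * (/ 2) ^ n).
  { intros n k. eapply Rle_trans; [apply D|]. pose proof (P (n + k)%nat). nra. }
  assert (E : ex_finite_lim_seq a).
  { apply ex_lim_seq_cauchy_corr. intros eps.
    (* Two terms beyond [N] differ from [a N] by at most [2 * A * (/ 2) ^ N] each; the added 1
       avoids dividing by zero when [A] is 0. *)
    destruct (pow_lt_1_zero (/ 2) ltac:(rewrite Rabs_right; lra) (eps / (4 * A + 1))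
      ltac:(apply Rdiv_lt_0_compat; [apply cond_pos|lra])) as [N HN].
    exists N. intros n m Hn Hm.
    specialize (HN N (Nat.le_refl N)). rewrite Rabs_right in HN by (apply Rle_ge, Rlt_le, P).
    apply (Rmult_lt_compat_l (4 * A + 1)) in HN; [|lra].
    replace ((4 * A + 1) * (eps / (4 * A + 1))) with (pos eps) in HN by (field; lra).
    pose proof (D' N (n - N)%nat) as H1. pose proof (D' N (m - N)%nat) as H2.
    replace (N + (n - N))%nat with n in H1 by lia.
    replace (N + (m - N))%nat with m in H2 by lia.
    replace (a n - a m) with ((a n - a N) - (a m - a N)) by ring.
    eapply Rle_lt_trans; [apply Rabs_triang|]. rewrite Rabs_Ropp.
    pose proof (P N). nra. }
  destruct E as [l El]. rewrite (is_lim_seq_unique _ _ El). simpl. intros n.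
  assert (H : Rbar_le (Finite (Rabs (a n - l))) (Finite (2 * A * (/ 2) ^ n))).
  { apply (is_lim_seq_le (fun k => Rabs (a n - a (k + n)%nat)) (fun _ => 2 * A * (/ 2) ^ n)).
    - intros k. rewrite Rabs_minus_sym, Nat.add_comm. apply D'.
    - apply (is_lim_seq_abs (fun k => a n - a (k + n)%nat) (a n - l)).
      apply is_lim_seq_minus'; [apply is_lim_seq_const|].
      apply (is_lim_seq_incr_n a n), El.
    - apply is_lim_seq_const. }
  exact H.
Qed.

Lemma Rle_geometric (a A : R) : (forall n, a <= A * (/ 2) ^ n) -> a <= 0.
Proof.
  intros H. apply Rnot_lt_le. intros Ha.
  assert (HA : 0 < A) by (specialize (H 0%nat); simpl in H; lra).
  destruct (pow_lt_1_zero (/ 2) ltac:(rewrite Rabs_right; lra) (a / A)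
    ltac:(apply Rdiv_lt_0_compat; lra)) as [N HN].
  specialize (HN N (Nat.le_refl N)). rewrite Rabs_right in HN by (apply Rle_ge, pow_le; lra).
  apply (Rmult_lt_compat_l A) in HN; [|lra].
  replace (A * (a / A)) with a in HN by (field; lra).
  specialize (H N). lra.
Qed.

(** The iterates converge uniformly on bounded times, so the limit is continuous; the Lipschitz
    bound carries the limit under the integral, and the integral equation is then differentiated.
    The derivative is asserted for positive times only, as the solution built here is constant to
    the left of 0. *)
Lemma global_picard_lindelof {I : Type} (F : R -> (I -> R) -> I -> R) (u0 : I -> R) :
  regular_field F -> exists u : R -> I -> R,
    (forall i, u 0 i = u0 i) /\ (forall i, cont (fun t => u t i)) /\
    forall t i, 0 < t -> is_derive (fun s => u s i) t (F t (u t) i).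
Proof.
  intros HF. destruct HF as [HC HL]. assert (HF : regular_field F) by (split; assumption).
  set (u := fun t i => real (Lim_seq (fun n => picard F u0 n (Rmax t 0) i))).
  assert (Hu : forall T, exists A, 0 <= A /\ forall n t i, t <= T ->
    Rabs (picard F u0 n (Rmax t 0) i - u t i) <= A * (/ 2) ^ n).
  { intros T. destruct (picard_step F u0 (Rmax T 0) HF) as [A [HA HP]].
    exists (2 * A). split; [lra|]. intros n t i Ht.
    apply (geometric_steps_cv (fun n => picard F u0 n (Rmax t 0) i) A).
    intros m. apply HP. split; [apply Rmax_r|]. apply Rle_max_compat_r, Ht. }
  assert (Cu : forall i, cont (fun t => u t i)).
  { intros i t. apply continuity_pt_filterlim.
    apply (CVU_continuity (fun n t => picard F u0 n (Rmax t 0) i) _ t (mkposreal 1 Rlt_0_1)).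
    - intros eps Heps. destruct (Hu (t + 1)) as [A [HA HP]].
      destruct (pow_lt_1_zero (/ 2) ltac:(rewrite Rabs_right; lra) (eps / (A + 1))
        ltac:(apply Rdiv_lt_0_compat; lra)) as [N HN].
      exists N. intros n s Hn Hs. rewrite Rabs_minus_sym.
      eapply Rle_lt_trans; [apply HP; unfold Boule in Hs; simpl in Hs;
        apply Rabs_def2 in Hs; lra|].
      specialize (HN n Hn). rewrite Rabs_right in HN by (apply Rle_ge, pow_le; lra).
      apply (Rmult_lt_compat_l (A + 1)) in HN; [|lra].
      replace ((A + 1) * (eps / (A + 1))) with eps in HN by (field; lra).
      assert (0 < (/ 2) ^ n) by (apply pow_lt; lra). nra.
    - intros n s _. apply cont_pt.
      apply (cont_comp (fun t => Rmax t 0) (fun t => picard F u0 n t i));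
        [apply cont_Rmax_0|apply picard_cont, HF].
    - unfold Boule. simpl. rewrite Rminus_diag, Rabs_R0. lra. }
  assert (CF : forall i, cont (fun s => F s (u s) i)) by (intros i; apply HC, Cu).
  assert (E : forall t i, 0 <= t -> u t i = u0 i + RInt (fun s => F s (u s) i) 0 t).
  { intros t i Ht. destruct (Hu t) as [A [HA HP]].
    destruct (HL t) as [B [L [_ [HL0 Hb]]]].
    apply Rminus_diag_uniq, Rabs_eq_0, Rle_antisym; [|apply Rabs_pos].
    (* The defect in the integral equation splits into the distance from [u] to the next iterate, at
       most [A * (/ 2) ^ n], and the difference of the two integrals, at most
       [t * (L * A) * (/ 2) ^ n]. *)
    apply Rle_geometric with (A + t * (L * A)). intros n.
    assert (H1 := HP (S n) t i (Rle_refl t)). rewrite Rmax_left in H1 by lra.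
    simpl in H1. rewrite Rmax_left in H1 by lra.
    assert (H2 : Rabs (RInt (fun s => F s (picard F u0 n s) i) 0 t
      - RInt (fun s => F s (u s) i) 0 t) <= RInt (fun _ => L * (A * (/ 2) ^ n)) 0 t).
    { apply Rabs_RInt_minus_le; [lra| |apply CF|apply cont_const|].
      - apply (HC (picard F u0 n)). intros j. apply picard_cont, HF.
      - intros s Hs. apply Hb; [lra|]. intros j.
        rewrite <- (Rmax_left s 0) at 1 by lra. apply HP. lra. }
    rewrite (RInt_const (V := R_CompleteNormedModule)) in H2.
    unfold scal in H2; simpl in H2; unfold mult in H2; simpl in H2.
    assert (0 < (/ 2) ^ n) by (apply pow_lt; lra).
    set (a := RInt _ 0 t) in *. set (b := RInt (fun s => F s (u s) i) 0 t) in *.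
    replace (u t i - (u0 i + b)) with ((a - b) - (u0 i + a - u t i)) by ring.
    eapply Rle_trans; [apply Rabs_triang|]. rewrite Rabs_Ropp.
    assert (0 <= A * (/ 2) ^ n) by nra. lra. }
  exists u. split; [|split; [exact Cu|]].
  - intros i. rewrite E by lra. rewrite (RInt_point (V := R_CompleteNormedModule)).
    unfold zero; simpl. ring.
  - intros t i Ht.
    (* The integral equation holds only for nonnegative times; the ball of radius [t] around [t]
       stays among them. *)
    apply (is_derive_ext_loc (fun b => u0 i + RInt (fun s => F s (u s) i) 0 b)).
    + exists (mkposreal t Ht). intros s Hs. symmetry. apply E.
      unfold ball in Hs; simpl in Hs. unfold AbsRing_ball, abs, minus, plus, opp in Hs.
      simpl in Hs. apply Rabs_def2 in Hs. lra.
    + evar_last.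
      * apply (is_derive_plus (K := R_AbsRing) (V := R_NormedModule)); [apply is_derive_const|].
        apply (is_derive_primitive (fun s => F s (u s) i)), CF.
      * unfold plus, zero; simpl. ring.
Qed.

(** * Monotone quantities *)

(** A purely syntactic test: the rates below are therefore written as sums of products of positive
    quantities and the gap z - y. *)
Ltac nonneg :=
  lazymatch goal with
  | |- 0 <= _ + _ => apply Rplus_le_le_0_compat; nonneg
  | |- 0 <= _ * _ => apply Rmult_le_pos; nonneg
  | |- 0 <= _ ^ _ => apply pow_le; nonneg
  | |- _ => lra
  end.

Ltac rewrite_derive H :=
  match type of H with is_derive ?f ?t ?l =>
    try replace (Derive (fun s : R => f s) t) with l
      by (symmetry; apply is_derive_unique; exact H) end.

Lemma nondecreasing_of_derive (f df : R -> R) (a b : R) :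
  a <= b -> cont f -> (forall t, a < t < b -> is_derive f t (df t)) ->
  (forall t, a < t < b -> 0 <= df t) -> f a <= f b.
Proof.
  intros Hab Hf Hd Hp. destruct (Req_dec a b) as [->|Hne]; [lra|].
  (* The mean value theorem may return an endpoint, where nothing is known about [df]; the value 0
     there keeps the sign. *)
  set (df' := fun t => match Rlt_dec a t, Rlt_dec t b with
                       | left _, left _ => df t | _, _ => 0 end).
  destruct (MVT_gen f a b df') as [c [_ Hc]].
  - rewrite Rmin_left, Rmax_right by lra. intros t Ht. unfold df'.
    destruct Rlt_dec; [|lra]. destruct Rlt_dec; [|lra]. apply Hd, Ht.
  - intros; apply cont_pt, Hf.
  - assert (0 <= df' c) by (unfold df'; do 2 (destruct Rlt_dec; [|lra]); apply Hp; lra).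
    nra.
Qed.

Lemma nonincreasing_of_derive (f df : R -> R) (a b : R) :
  a <= b -> cont f -> (forall t, a < t < b -> is_derive f t (df t)) ->
  (forall t, a < t < b -> df t <= 0) -> f b <= f a.
Proof.
  intros Hab Hf Hd Hp.
  apply Ropp_le_cancel, (nondecreasing_of_derive (fun t => - f t) (fun t => - df t));
    [exact Hab|apply cont_opp, Hf| |].
  - intros t Ht. apply (is_derive_opp (K := R_AbsRing) (V := R_NormedModule)), Hd, Ht.
  - intros t Ht. specialize (Hp t Ht). lra.
Qed.

(* f^2 exp(2Mt) is nondecreasing and f^2 exp(-2Mt) nonincreasing, where M bounds the
   logarithmic derivative on [0, t]. *)
Lemma linear_ode_square (f k K : R -> R) :
  cont f -> cont K -> (forall t, 0 < t -> is_derive f t (k t * f t)) ->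
  (forall t, 0 < t -> Rabs (k t) <= K t) -> forall t, 0 <= t -> exists M,
    f 0 ^ 2 <= f t ^ 2 * exp (2 * M * t) /\ f t ^ 2 * exp (- (2 * M) * t) <= f 0 ^ 2.
Proof.
  intros Hf HK Hd Hk T HT.
  destruct (cont_bounded K 0 T HK) as [M [HM HB]]. exists M.
  assert (Hkm : forall t, 0 < t < T -> - M <= k t <= M).
  { intros t Ht. specialize (Hk t ltac:(lra)). specialize (HB t ltac:(lra)).
    pose proof (Rle_abs (K t)). split; [|pose proof (Rle_abs (k t)); lra].
    pose proof (Rle_abs (- k t)) as H1. rewrite Rabs_Ropp in H1. lra. }
  assert (D : forall c t, 0 < t < T ->
    is_derive (fun s => f s ^ 2 * exp (c * s)) t ((2 * k t + c) * f t ^ 2 * exp (c * t))).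
  { intros c t Ht. auto_derive.
    - eexists. apply Hd. lra.
    - rewrite_derive (Hd t ltac:(lra)). simpl. ring. }
  assert (E : forall c t, 0 <= f t ^ 2 * exp (c * t)).
  { intros c t. apply Rmult_le_pos; [nra|]. apply Rlt_le, exp_pos. }
  assert (C : forall c, cont (fun t => f t ^ 2 * exp (c * t))).
  { intros c. apply cont_mult; [apply cont_pow, Hf|apply cont_exp_linear]. }
  assert (E0 : forall c, f 0 ^ 2 * exp (c * 0) = f 0 ^ 2)
    by (intros c; rewrite Rmult_0_r, exp_0; ring).
  split.
  - rewrite <- (E0 (2 * M)).
    apply (nondecreasing_of_derive (fun t => f t ^ 2 * exp (2 * M * t)) _ 0 T HT (C _) (D _)).
    intros t Ht. rewrite Rmult_assoc. apply Rmult_le_pos; [|apply E].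
    specialize (Hkm t Ht). lra.
  - rewrite <- (E0 (- (2 * M))).
    apply (nonincreasing_of_derive (fun t => f t ^ 2 * exp (- (2 * M) * t)) _ 0 T HT (C _) (D _)).
    intros t Ht. rewrite Rmult_assoc.
    specialize (Hkm t Ht). specialize (E (- (2 * M)) t). nra.
Qed.

(** The first inequality of [linear_ode_square] excludes zeros, and the intermediate value theorem
    then excludes a change of sign. In the applications [k] carries the damping factor, known only
    to lie in [0, 1], so the local bounds come from a continuous majorant [K]. *)
Lemma linear_ode_pos (f k K : R -> R) :
  cont f -> cont K -> (forall t, 0 < t -> is_derive f t (k t * f t)) ->
  (forall t, 0 < t -> Rabs (k t) <= K t) -> 0 < f 0 -> forall t, 0 <= t -> 0 < f t.
Proof.
  intros Hf HK Hd Hk H0.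
  assert (N : forall t, 0 <= t -> f t <> 0).
  { intros t Ht E. destruct (linear_ode_square f k K Hf HK Hd Hk t Ht) as [M [H _]].
    rewrite E in H. simpl in H. nra. }
  intros t Ht. apply Rnot_le_lt. intros Hn.
  destruct (IVT_gen f 0 t 0) as [c [Hc E]].
  - intros s. apply cont_pt, Hf.
  - rewrite Rmin_right, Rmax_left by lra. lra.
  - rewrite Rmin_left, Rmax_right in Hc by lra. apply (N c); [lra|exact E].
Qed.

(** Meant for the gap z - y, which vanishes initially when h22 = h33; in that case the second
    inequality of [linear_ode_square] keeps it zero. *)
Lemma linear_ode_nonneg (f k K : R -> R) :
  cont f -> cont K -> (forall t, 0 < t -> is_derive f t (k t * f t)) ->
  (forall t, 0 < t -> Rabs (k t) <= K t) -> 0 <= f 0 -> forall t, 0 <= t -> 0 <= f t.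
Proof.
  intros Hf HK Hd Hk H0 t Ht. destruct (Req_dec (f 0) 0) as [E|Hne].
  - destruct (linear_ode_square f k K Hf HK Hd Hk t Ht) as [M [_ H]].
    rewrite E in H. pose proof (exp_pos (- (2 * M) * t)).
    assert (f t ^ 2 <= 0) by nra. nra.
  - apply Rlt_le, (linear_ode_pos f k K); try assumption. lra.
Qed.

(* If x, y, z solve (SL) then z - y has logarithmic derivative
   - beta g00^2 gap_rate x y z: this is (z q(z,-x,y) - y q(y,-x,z)) / (z - y). *)
Definition gap_rate (x y z : R) : R :=
  z * (3*y^3 + 2*y^2*z + 2*y*z^2 + 5*z^3 + x*(3*y^2 + 2*y*z + 3*z^2) + x^3)
  + y * (5*y^3 + 2*y^2*z + 2*y*z^2 + 3*z^3 + x*(3*y^2 + 2*y*z + 3*z^2) + x^3)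
  - (3*x^4 + 2*x^3*(y+z) + x^2*y*z).

(** For x <= 1 the left side is at most 6 y^2 z^2, and in the variables x, y - x and z - y the
    remaining difference has nonnegative coefficients. Since 6 beta g00^2 x^2 y^2 z^2 = 1 along the
    flow, this gives the gap a decay rate of at least 1. *)
Lemma gap_rate_ge (x y z : R) :
  0 < x <= 1 -> x <= y -> y <= z -> 6 * (x ^ 2 * y ^ 2 * z ^ 2) <= gap_rate x y z.
Proof.
  intros Hx Hxy Hyz.
  assert (E1 : x ^ 2 * y ^ 2 * z ^ 2 <= y ^ 2 * z ^ 2).
  { assert (x ^ 2 <= 1 ^ 2) by (apply pow_incr; lra).
    assert (0 <= y ^ 2 * z ^ 2) by nonneg. nra. }
  set (e := y - x). set (d := z - y).
  assert (0 <= e) by (unfold e; lra). assert (0 <= d) by (unfold d; lra).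
  assert (E2 : 0 <= gap_rate x y z - 6 * (y ^ 2 * z ^ 2)).
  { replace z with (x + e + d) by (unfold d, e; ring).
    replace y with (x + e) by (unfold e; ring). unfold gap_rate.
    ring_simplify. nonneg. }
  lra.
Qed.

(* Bach flow slowed down by a factor chi in [0, 1]. All a priori estimates are signs of
   derivatives, so they do not depend on chi, and apply as well to a solution of the
   truncated system used for existence. *)
Definition damped_SL (b : R) (chi g0 x y z : R -> R) (h0 h1 h2 h3 : R) : Prop :=
  (g0 0 = h0 /\ x 0 = h1 /\ y 0 = h2 /\ z 0 = h3) /\
  (cont g0 /\ cont x /\ cont y /\ cont z) /\
  forall t, 0 < t -> 0 <= chi t <= 1 /\
    is_derive g0 t (- (chi t * b * g0 t ^ 2 * p_poly (- x t) (y t) (z t)) * g0 t) /\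
    is_derive x t (- (chi t * b * g0 t ^ 2 * q_poly (- x t) (y t) (z t)) * x t) /\
    is_derive y t (- (chi t * b * g0 t ^ 2 * q_poly (y t) (- x t) (z t)) * y t) /\
    is_derive z t (- (chi t * b * g0 t ^ 2 * q_poly (z t) (- x t) (y t)) * z t).

(** With X = h1 h3 / h2 an upper bound for x, and y, z >= h2, this bounds (3 x^2 + 2 x (y + z) + y
    z) / (6 y^2 z^2), which dominates the logarithmic derivative of z. *)
Definition growth_rate (h1 h2 h3 : R) : R :=
  (3 * (h1 * h3 / h2) ^ 2 / h2 ^ 4 + 4 * (h1 * h3 / h2) / h2 ^ 3 + 1 / h2 ^ 2) / 6.

(** The sum of the separate bounds for g00, for x, and for y <= z: one continuous radius valid for
    all four coordinates. *)
Definition box_radius (h0 h1 h2 h3 t : R) : R :=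
  h0 + h1 * h3 / h2 + h3 * exp (growth_rate h1 h2 h3 * t).

(** * A priori estimates along the damped flow *)

Section Estimates.

Variables (b h0 h1 h2 h3 : R) (chi g0 x y z : R -> R).
Hypotheses (h0_pos : 0 < h0) (h1_pos : 0 < h1) (h2_pos : 0 < h2) (h23 : h2 <= h3).
Hypothesis b_eq : 6 * b * (h0 * h1 * h2 * h3) ^ 2 = 1.
Hypothesis sol : damped_SL b chi g0 x y z h0 h1 h2 h3.

Let growth : R := growth_rate h1 h2 h3.
Let kap (t : R) : R := chi t * b * g0 t ^ 2.

Let D0 : g0 0 = h0. Proof. apply sol. Qed.
Let D1 : x 0 = h1. Proof. apply sol. Qed.
Let D2 : y 0 = h2. Proof. apply sol. Qed.
Let D3 : z 0 = h3. Proof. apply sol. Qed.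
Let C0 : cont g0. Proof. apply sol. Qed.
Let C1 : cont x. Proof. apply sol. Qed.
Let C2 : cont y. Proof. apply sol. Qed.
Let C3 : cont z. Proof. apply sol. Qed.

Lemma b_pos : 0 < b.
Proof.
  assert (0 < (h0 * h1 * h2 * h3) ^ 2).
  { apply pow_lt. repeat apply Rmult_lt_0_compat; lra. }
  nra.
Qed.

Let damping_bound (K : R -> R) (t : R) : 0 < t ->
  Rabs (- (chi t * b * g0 t ^ 2 * K t)) <= Rabs (b * g0 t ^ 2 * K t).
Proof.
  intros Ht. destruct sol as [_ [_ Hs]]. destruct (Hs t Ht) as [Hc _].
  replace (- (chi t * b * g0 t ^ 2 * K t)) with (- chi t * (b * g0 t ^ 2 * K t)) by ring.
  rewrite Rabs_mult, Rabs_Ropp, (Rabs_right (chi t)) by lra.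
  pose proof (Rabs_pos (b * g0 t ^ 2 * K t)). nra.
Qed.

Let bound_cont (K : R -> R) : cont K -> cont (fun t => Rabs (b * g0 t ^ 2 * K t)).
Proof.
  intros HK. apply cont_Rabs. cont_auto.
Qed.

Let damped_pos (f K : R -> R) : cont f -> cont K ->
  (forall t, 0 < t -> is_derive f t (- (kap t * K t) * f t)) ->
  0 < f 0 -> forall t, 0 <= t -> 0 < f t.
Proof.
  intros Hf HK Hd. apply (linear_ode_pos f (fun t => - (kap t * K t)) _ Hf (bound_cont K HK) Hd).
  intros t Ht. apply (damping_bound K t Ht).
Qed.

Let damped_nonneg (f K : R -> R) : cont f -> cont K ->
  (forall t, 0 < t -> is_derive f t (- (kap t * K t) * f t)) ->
  0 <= f 0 -> forall t, 0 <= t -> 0 <= f t.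
Proof.
  intros Hf HK Hd. apply (linear_ode_nonneg f (fun t => - (kap t * K t)) _ Hf (bound_cont K HK) Hd).
  intros t Ht. apply (damping_bound K t Ht).
Qed.

Lemma g0_pos (t : R) : 0 <= t -> 0 < g0 t.
Proof.
  revert t. apply (damped_pos g0 (fun t => p_poly (- x t) (y t) (z t)) C0).
  - unfold p_poly. cont_auto.
  - intros t Ht. apply sol, Ht.
  - lra.
Qed.

Lemma x_pos (t : R) : 0 <= t -> 0 < x t.
Proof.
  revert t. apply (damped_pos x (fun t => q_poly (- x t) (y t) (z t)) C1).
  - unfold q_poly. cont_auto.
  - intros t Ht. apply sol, Ht.
  - lra.
Qed.

Lemma y_pos (t : R) : 0 <= t -> 0 < y t.
Proof.
  revert t. apply (damped_pos y (fun t => q_poly (y t) (- x t) (z t)) C2).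
  - unfold q_poly. cont_auto.
  - intros t Ht. apply sol, Ht.
  - lra.
Qed.

Ltac derive t Ht :=
  let d0 := fresh in let d1 := fresh in let d2 := fresh in let d3 := fresh in let hs := fresh in
  destruct sol as [_ [_ hs]]; destruct (hs t Ht) as [_ [d0 [d1 [d2 d3]]]];
  auto_derive;
  [ repeat split; eexists; eassumption
  | rewrite_derive d0; rewrite_derive d1; rewrite_derive d2; rewrite_derive d3;
    unfold kap, p_poly, q_poly; simpl; ring ].

Lemma gap_derive (t : R) : 0 < t ->
  is_derive (fun s => z s - y s) t
    (- (kap t * gap_rate (x t) (y t) (z t)) * (z t - y t)).
Proof. intros Ht. unfold gap_rate. derive t Ht. Qed.

Lemma y_le_z (t : R) : 0 <= t -> y t <= z t.
Proof.
  intros Ht. apply Rge_le, Rminus_ge, Rle_ge. revert t Ht.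
  apply (damped_nonneg (fun s => z s - y s) (fun t => gap_rate (x t) (y t) (z t))).
  - cont_auto.
  - unfold gap_rate. cont_auto.
  - apply gap_derive.
  - lra.
Qed.

Lemma kap_nonneg (t : R) : 0 < t -> 0 <= kap t.
Proof.
  intros Ht. destruct sol as [_ [_ Hs]]. destruct (Hs t Ht) as [Hc _].
  pose proof b_pos. pose proof (g0_pos t ltac:(lra)). unfold kap. nonneg.
Qed.

(** The four logarithmic derivatives sum to zero, since p and the three values of q cancel
    identically; geometrically, the Bach tensor is trace-free. *)
Lemma volume_conserved (t : R) : 0 <= t -> g0 t * x t * y t * z t = h0 * h1 * h2 * h3.
Proof.
  intros Ht. rewrite <- D0, <- D1, <- D2, <- D3.
  assert (D : forall s, 0 < s < t -> is_derive (fun s => g0 s * x s * y s * z s) s 0).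
  { intros s [Hs0 _]. derive s Hs0. }
  assert (C : cont (fun s => g0 s * x s * y s * z s)) by cont_auto.
  apply Rle_antisym.
  - apply (nonincreasing_of_derive _ _ 0 t Ht C D). intros; lra.
  - apply (nondecreasing_of_derive _ _ 0 t Ht C D). intros; lra.
Qed.

(** Conservation of volume eliminates g00: the common factor of all rates becomes chi / (6 x^2 y^2
    z^2). *)
Lemma kap_eq (t : R) : 0 <= t -> 6 * kap t * (x t ^ 2 * y t ^ 2 * z t ^ 2) = chi t.
Proof.
  intros Ht. unfold kap.
  transitivity (chi t * (6 * b * (g0 t * x t * y t * z t) ^ 2)); [ring|].
  rewrite volume_conserved, b_eq by exact Ht. ring.
Qed.

Ltac signs s :=
  pose proof (kap_nonneg s ltac:(lra)) as Pk; pose proof (g0_pos s ltac:(lra)) as Pg;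
  pose proof (x_pos s ltac:(lra)) as Px; pose proof (y_pos s ltac:(lra)) as Py;
  pose proof (y_le_z s ltac:(lra)) as Pyz.

Lemma g0_le (t : R) : 0 <= t -> g0 t <= h0.
Proof.
  intros Ht. rewrite <- D0.
  apply (nonincreasing_of_derive g0
    (fun t => - (kap t * p_poly (- x t) (y t) (z t)) * g0 t) 0 t Ht C0).
  - intros s Hs. apply sol. lra.
  - intros s Hs. rewrite <- Ropp_mult_distr_l.
    signs s.
    apply Rge_le, Ropp_0_le_ge_contravar.
    (* Here y^4 - y^3 z - y z^3 + z^4 = (z - y)^2 (y^2 + y z + z^2), and the terms linear in x also
       contain the square of the gap. *)
    replace (p_poly (- x s) (y s) (z s)) with (x s ^ 4 + x s ^ 3 * (y s + z s) + x s ^ 2 * y s * z s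
      + x s * (y s + z s) * (z s - y s) ^ 2
      + (z s - y s) ^ 2 * (y s ^ 2 + y s * z s + z s ^ 2)) by (unfold p_poly; ring).
    nonneg.
Qed.

(* y' / y = kap y_rate x y z *)
Let y_rate (x y z : R) : R :=
  3*x^4 + 2*x^3*(y+z) + x^2*y*z
  + (z-y) * (5*y^3 + 2*y^2*z + 2*y*z^2 + 3*z^3 + x*(3*y^2 + 2*y*z + 3*z^2) + x^3).

Lemma y_ge (t : R) : 0 <= t -> h2 <= y t.
Proof.
  intros Ht. rewrite <- D2.
  apply (nondecreasing_of_derive y (fun t => kap t * y_rate (x t) (y t) (z t) * y t) 0 t Ht C2).
  - intros s [Hs _]. replace (kap s * y_rate (x s) (y s) (z s) * y s)
      with (- (kap s * q_poly (y s) (- x s) (z s)) * y s)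
      by (unfold y_rate, q_poly; ring).
    apply sol, Hs.
  - intros s Hs. signs s. unfold y_rate. nonneg.
Qed.

(* By conservation of volume g0 x z^2 is a multiple of z / y. *)
Lemma ratio_le (t : R) : 0 <= t -> h2 * z t <= h3 * y t.
Proof.
  intros Ht.
  assert (H : g0 t * x t * z t ^ 2 <= h0 * h1 * h3 ^ 2).
  { rewrite <- D0, <- D1, <- D3.
    apply (nonincreasing_of_derive (fun t => g0 t * x t * z t ^ 2)
      (fun t => - (kap t * (g0 t * x t * z t ^ 2) * ((z t - y t) *
        (8*y t^3 + 4*y t^2*z t + 4*y t*z t^2 + 8*z t^3
         + x t*(6*y t^2 + 4*y t*z t + 6*z t^2) + 2*x t^3)))) 0 t Ht).
    - cont_auto.
    - intros s [Hs _]. derive s Hs.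
    - intros s Hs. apply Rge_le, Ropp_0_le_ge_contravar. signs s. nonneg. }
  pose proof (volume_conserved t Ht) as V. pose proof (y_pos t Ht).
  apply (Rmult_le_reg_l (h0 * h1 * h3)); [repeat apply Rmult_lt_0_compat; lra|].
  replace (h0 * h1 * h3 * (h2 * z t)) with (g0 t * x t * z t ^ 2 * y t)
    by (transitivity (g0 t * x t * y t * z t * z t); [ring|rewrite V; ring]).
  replace (h0 * h1 * h3 * (h3 * y t)) with (h0 * h1 * h3 ^ 2 * y t) by ring.
  apply Rmult_le_compat_r; lra.
Qed.

Lemma xz_le (t : R) : 0 <= t -> x t * z t <= h1 * h3.
Proof.
  intros Ht. rewrite <- D1, <- D3.
  apply (nonincreasing_of_derive (fun t => x t * z t)
    (fun t => - (kap t * (x t * z t) *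
      (2*x t^4 + x t^3*(y t + z t) + (z t - y t) *
        (6*y t^3 + 2*y t^2*z t + 2*y t*z t^2 + 2*z t^3
         + x t*(4*y t^2 + 2*y t*z t + 2*z t^2) + x t^3)))) 0 t Ht).
  - cont_auto.
  - intros s [Hs _]. derive s Hs.
  - intros s Hs. apply Rge_le, Ropp_0_le_ge_contravar. signs s. nonneg.
Qed.

(** The exponents 3 and 5 cancel the x^4 terms, whose coefficients are 5 in q(-x,y,z) and -3 in
    q(y,-x,z). The bound limits how fast x can decay relative to y, which is what forces g00 to
    0. *)
Lemma x3y5_ge (t : R) : 0 <= t -> h1 ^ 3 * h2 ^ 5 <= x t ^ 3 * y t ^ 5.
Proof.
  intros Ht. rewrite <- D1, <- D2.
  apply (nondecreasing_of_derive (fun t => x t ^ 3 * y t ^ 5)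
    (fun t => kap t * (x t ^ 3 * y t ^ 5) *
      (x t^3*(y t + z t) + 2*x t^2*y t*z t + (z t - y t) *
        (16*y t^3 + 10*y t^2*z t + 10*y t*z t^2 + 24*z t^3
         + x t*(12*y t^2 + 10*y t*z t + 18*z t^2) + 5*x t^3))) 0 t Ht).
  - cont_auto.
  - intros s [Hs _]. derive s Hs.
  - intros s Hs. signs s. nonneg.
Qed.

Lemma x_le (t : R) : 0 <= t -> x t <= h1 * h3 / y t.
Proof.
  intros Ht. pose proof (y_pos t Ht). pose proof (x_pos t Ht).
  apply (Rmult_le_reg_r (y t)); [lra|]. unfold Rdiv. rewrite Rmult_assoc, Rinv_l by lra.
  pose proof (xz_le t Ht). pose proof (y_le_z t Ht). nra.
Qed.

Lemma x_le_init (t : R) : 0 <= t -> x t <= h1 * h3 / h2.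
Proof.
  intros Ht. eapply Rle_trans; [apply x_le, Ht|].
  apply Rmult_le_compat_l; [nra|]. apply Rinv_le_contravar; [lra|apply y_ge, Ht].
Qed.

Let le_scaled (k m n : R) : 0 <= k -> 0 < m -> m <= n -> k <= k / m * n.
Proof.
  intros Hk Hm Hn. replace k with (k / m * m) at 1 by (field; lra).
  apply Rmult_le_compat_l; [|exact Hn]. apply Rmult_le_pos; [exact Hk|].
  apply Rlt_le, Rinv_0_lt_compat, Hm.
Qed.

(** The part of -q(z,-x,y) containing the factor z - y is nonpositive and is dropped, which leaves
    x^2 [E]. The x^2 cancels against [kap] by [kap_eq], so a small x does no harm, and the bounds on
    x, y, z control what remains. *)
Lemma z_rate_le (t : R) : 0 < t -> - (kap t * q_poly (z t) (- x t) (y t)) <= growth.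
Proof.
  intros Ht. signs t. pose proof (y_ge t ltac:(lra)) as Hy.
  pose proof (x_le_init t ltac:(lra)) as Hx. set (X := h1 * h3 / h2) in *.
  assert (Hz : h2 <= z t) by lra.
  set (E := 3 * x t ^ 2 + 2 * x t * (y t + z t) + y t * z t).
  assert (H1 : - (kap t * q_poly (z t) (- x t) (y t)) <= kap t * (x t ^ 2 * E)).
  { assert (0 <= kap t * ((z t - y t) * (3*y t^3 + 2*y t^2*z t + 2*y t*z t^2 + 5*z t^3
      + x t*(3*y t^2 + 2*y t*z t + 3*z t^2) + x t^3))) by nonneg.
    apply Rminus_le. apply Ropp_le_cancel. rewrite Ropp_0.
    eapply Rle_trans; [eassumption|]. apply Req_le. unfold E, q_poly. ring. }
  (* Each monomial of [E] is compared with y^2 z^2, by x <= [X] and y, z >= [h2]; the four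
     comparisons add up to the terms of [growth_rate]. *)
  assert (H2 : E <= 6 * growth * (y t ^ 2 * z t ^ 2)).
  { assert (Y2 : h2 ^ 2 <= y t ^ 2) by (apply pow_incr; lra).
    assert (Z2 : h2 ^ 2 <= z t ^ 2) by (apply pow_incr; lra).
    assert (P2 : 0 < h2 ^ 2) by (apply pow_lt; lra).
    assert (0 <= X) by lra.
    assert (A1 : 3 * X ^ 2 <= 3 * X ^ 2 / h2 ^ 4 * (y t ^ 2 * z t ^ 2)).
    { apply le_scaled; [nonneg|apply pow_lt; lra|].
      replace (h2 ^ 4) with (h2 ^ 2 * h2 ^ 2) by ring. apply Rmult_le_compat; lra. }
    assert (A2 : 2 * X <= 2 * X / h2 ^ 3 * (y t * z t ^ 2)).
    { apply le_scaled; [nonneg|apply pow_lt; lra|].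
      replace (h2 ^ 3) with (h2 * h2 ^ 2) by ring. apply Rmult_le_compat; lra. }
    assert (A3 : 2 * X <= 2 * X / h2 ^ 3 * (y t ^ 2 * z t)).
    { apply le_scaled; [nonneg|apply pow_lt; lra|].
      replace (h2 ^ 3) with (h2 ^ 2 * h2) by ring. apply Rmult_le_compat; lra. }
    assert (A4 : 1 <= 1 / h2 ^ 2 * (y t * z t)).
    { apply le_scaled; [lra|lra|]. simpl. rewrite Rmult_1_r. apply Rmult_le_compat; lra. }
    assert (B1 : 3 * x t ^ 2 <= 3 * X ^ 2).
    { apply Rmult_le_compat_l; [lra|]. apply pow_incr; lra. }
    assert (B2 : 2 * x t * y t <= 2 * X * y t) by nra.
    assert (B3 : 2 * x t * z t <= 2 * X * z t) by nra.
    apply (Rmult_le_compat_r (y t)) in A2; [|lra].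
    apply (Rmult_le_compat_r (z t)) in A3; [|lra].
    apply (Rmult_le_compat_r (y t * z t)) in A4; [|nra].
    unfold E. replace (6 * growth * (y t ^ 2 * z t ^ 2)) with
      (3 * X ^ 2 / h2 ^ 4 * (y t ^ 2 * z t ^ 2) + 2 * X / h2 ^ 3 * (y t * z t ^ 2) * y t
       + 2 * X / h2 ^ 3 * (y t ^ 2 * z t) * z t + 1 / h2 ^ 2 * (y t * z t) * (y t * z t))
      by (unfold growth, growth_rate; fold X; field; lra).
    lra. }
  (* The final bound is [growth * chi t]; the sign of [growth] allows replacing [chi t] by 1. *)
  assert (HG : 0 <= growth).
  { assert (0 < y t ^ 2 * z t ^ 2) by (apply Rmult_lt_0_compat; apply pow_lt; lra).
    assert (0 <= E) by (unfold E; nonneg). nra. }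
  pose proof (kap_eq t ltac:(lra)) as K.
  destruct sol as [_ [_ Hs]]. destruct (Hs t Ht) as [Hc _].
  eapply Rle_trans; [exact H1|].
  apply Rle_trans with (kap t * (x t ^ 2 * (6 * growth * (y t ^ 2 * z t ^ 2)))).
  - apply Rmult_le_compat_l; [lra|]. apply Rmult_le_compat_l; [nra|exact H2].
  - replace (kap t * (x t ^ 2 * (6 * growth * (y t ^ 2 * z t ^ 2)))) with (growth * (6 * kap t * (x t ^ 2 * y t ^ 2 * z t ^ 2))) by ring.
    rewrite K. nra.
Qed.

(** Gronwall's argument: z exp(- growth t) is nonincreasing. *)
Lemma z_le (t : R) : 0 <= t -> z t <= h3 * exp (growth * t).
Proof.
  intros Ht.
  assert (H : z t * exp (- growth * t) <= z 0 * exp (- growth * 0)).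
  { apply (nonincreasing_of_derive (fun t => z t * exp (- growth * t))
      (fun t => (- (kap t * q_poly (z t) (- x t) (y t)) - growth) * z t * exp (- growth * t))
      0 t Ht).
    - apply cont_mult; [exact C3|apply cont_exp_linear].
    - intros s [Hs _]. destruct sol as [_ [_ Hd]]. destruct (Hd s Hs) as [_ [_ [_ [_ d3]]]].
      auto_derive; [eexists; eassumption|].
      rewrite_derive d3. unfold kap. ring.
    - intros s Hs. signs s. pose proof (z_rate_le s ltac:(lra)).
      pose proof (exp_pos (- growth * s)).
      rewrite Rmult_assoc. assert (0 <= z s * exp (- growth * s)) by nra. nra. }
  rewrite D3, Rmult_0_r, exp_0, Rmult_1_r in H.
  apply (Rmult_le_compat_r (exp (growth * t))) in H; [|apply Rlt_le, exp_pos].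
  rewrite Rmult_assoc, <- exp_plus in H.
  replace (- growth * t + growth * t) with 0 in H by ring.
  rewrite exp_0, Rmult_1_r in H. exact H.
Qed.

(** The radius does not involve [chi]. A solution of the truncated system therefore stays where all
    cutoffs equal 1. *)
Lemma box (t : R) : 0 <= t ->
  let N := box_radius h0 h1 h2 h3 t in
  Rabs (g0 t) <= N /\ Rabs (x t) <= N /\ Rabs (y t) <= N /\ Rabs (z t) <= N.
Proof.
  intros Ht N. unfold N, box_radius. fold growth. pose proof (g0_pos t Ht).
  pose proof (g0_le t Ht). pose proof (x_pos t Ht). pose proof (x_le_init t Ht).
  pose proof (y_pos t Ht). pose proof (y_le_z t Ht). pose proof (z_le t Ht).
  rewrite !Rabs_right by lra. lra.
Qed.

(** * Asymptotics of the undamped flow *)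

Hypothesis undamped : forall t, 0 < t -> chi t = 1.

Lemma y_sq_ge (t : R) : 0 <= t -> h2 ^ 2 + h2 / (3 * h3) * t <= y t ^ 2.
Proof.
  intros Ht. set (c := h2 / (3 * h3)).
  assert (H : y 0 ^ 2 - c * 0 <= y t ^ 2 - c * t).
  { apply (nondecreasing_of_derive (fun t => y t ^ 2 - c * t)
      (fun t => 2 * kap t * y_rate (x t) (y t) (z t) * y t ^ 2 - c) 0 t Ht).
    - cont_auto.
    - intros s [Hs _]. unfold y_rate. derive s Hs.
    - intros s Hs. signs s. pose proof (ratio_le s ltac:(lra)) as Hr.
      (* Of the rate of y only the term x^2 y z is kept: multiplied by 2 [kap] y^2 it equals y / (3
         z), which [ratio_le] bounds below by the constant [c]. *)
      assert (H1 : x s ^ 2 * y s * z s <= y_rate (x s) (y s) (z s)).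
      { apply Rge_le, Rminus_ge, Rle_ge.
        replace (y_rate (x s) (y s) (z s) - x s ^ 2 * y s * z s) with
          (3*x s^4 + 2*x s^3*(y s+z s)
           + (z s-y s) * (5*y s^3 + 2*y s^2*z s + 2*y s*z s^2 + 3*z s^3
              + x s*(3*y s^2 + 2*y s*z s + 3*z s^2) + x s^3)) by (unfold y_rate; ring).
        nonneg. }
      assert (H2 : c <= 2 * kap s * (x s ^ 2 * y s * z s) * y s ^ 2).
      { apply (Rmult_le_reg_r (3 * h3 * z s)); [nra|].
        replace (c * (3 * h3 * z s)) with (h2 * z s) by (unfold c; field; lra).
        replace (2 * kap s * (x s ^ 2 * y s * z s) * y s ^ 2 * (3 * h3 * z s))
          with (h3 * y s * (6 * kap s * (x s ^ 2 * y s ^ 2 * z s ^ 2))) by ring.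
        rewrite kap_eq, undamped by lra. lra. }
      assert (0 <= 2 * kap s * y s ^ 2) by nonneg. nra. }
  rewrite D2 in H. lra.
Qed.

Lemma y_infty : tends_to_pinfty y.
Proof.
  intros M. assert (Hc : 0 < h2 / (3 * h3)) by (apply Rdiv_lt_0_compat; lra).
  set (c := h2 / (3 * h3)) in *. exists (Rmax 0 (M ^ 2 / c)). intros t Ht.
  pose proof (Rmax_l 0 (M ^ 2 / c)). pose proof (Rmax_r 0 (M ^ 2 / c)).
  assert (E1 : M ^ 2 <= c * t).
  { replace (M ^ 2) with (c * (M ^ 2 / c)) by (field; lra). apply Rmult_le_compat_l; lra. }
  pose proof (y_sq_ge t ltac:(lra)) as E2. fold c in E2. pose proof (y_pos t ltac:(lra)).
  apply Rnot_le_gt. intros Hn. assert (0 < h2 ^ 2) by nra. nra.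
Qed.

Lemma z_infty : tends_to_pinfty z.
Proof.
  intros M. destruct (y_infty M) as [T HT]. exists (Rmax 0 T). intros t Ht.
  pose proof (Rmax_l 0 T). pose proof (Rmax_r 0 T).
  specialize (HT t ltac:(lra)). pose proof (y_le_z t ltac:(lra)). lra.
Qed.

Lemma x_to_0 : tends_to_at_infty x 0.
Proof.
  intros eps Heps. destruct (y_infty (h1 * h3 / eps)) as [T HT]. exists (Rmax 0 T). intros t Ht.
  pose proof (Rmax_l 0 T). pose proof (Rmax_r 0 T). specialize (HT t ltac:(lra)).
  pose proof (x_pos t ltac:(lra)). pose proof (y_pos t ltac:(lra)).
  pose proof (y_le_z t ltac:(lra)). pose proof (xz_le t ltac:(lra)).
  rewrite Rminus_0_r, Rabs_right by lra.
  apply (Rmult_gt_compat_r eps) in HT; [|lra].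
  replace (h1 * h3 / eps * eps) with (h1 * h3) in HT by (field; lra).
  apply (Rmult_lt_reg_r (y t)); nra.
Qed.

(** With V the conserved volume and y <= z, V^3 = (g00 x y z)^3 >= g00^3 y (x^3 y^5) >= c y g00^3,
    and y tends to infinity. *)
Lemma g0_to_0 : tends_to_at_infty g0 0.
Proof.
  intros eps Heps. set (V := h0 * h1 * h2 * h3). set (c := h1 ^ 3 * h2 ^ 5).
  assert (Hc : 0 < c) by (apply Rmult_lt_0_compat; apply pow_lt; lra).
  assert (He : 0 < eps ^ 3) by (apply pow_lt; lra).
  destruct (y_infty (V ^ 3 / (c * eps ^ 3))) as [T HT]. exists (Rmax 0 T). intros t Ht.
  pose proof (Rmax_l 0 T). pose proof (Rmax_r 0 T). specialize (HT t ltac:(lra)).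
  pose proof (g0_pos t ltac:(lra)). pose proof (x_pos t ltac:(lra)).
  pose proof (y_pos t ltac:(lra)). pose proof (y_le_z t ltac:(lra)).
  rewrite Rminus_0_r, Rabs_right by lra.
  apply Rnot_le_lt. intros Hn.
  apply (Rmult_gt_compat_r (c * eps ^ 3)) in HT; [|nra].
  replace (V ^ 3 / (c * eps ^ 3) * (c * eps ^ 3)) with (V ^ 3) in HT by (field; lra).
  assert (E1 : y t * (c * eps ^ 3) <= y t * (x t ^ 3 * y t ^ 5 * g0 t ^ 3)).
  { apply Rmult_le_compat_l; [lra|]. apply Rmult_le_compat; try lra.
    - apply x3y5_ge. lra.
    - apply pow_incr. lra. }
  assert (E2 : y t * (x t ^ 3 * y t ^ 5 * g0 t ^ 3) <= V ^ 3).
  { unfold V. rewrite <- (volume_conserved t) by lra.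
    replace (y t * (x t ^ 3 * y t ^ 5 * g0 t ^ 3))
      with ((g0 t * x t * y t) ^ 3 * y t ^ 3) by ring.
    rewrite (Rpow_mult_distr (g0 t * x t * y t) (z t)).
    apply Rmult_le_compat_l; [nonneg|]. apply pow_incr. lra. }
  lra.
Qed.

Lemma gap_to_0 : tends_to_at_infty (fun t => z t - y t) 0.
Proof.
  (* Beyond these times x < 1 < y, which supplies both x <= 1 and x <= y for [gap_rate_ge]. *)
  destruct (y_infty 1) as [T1 HT1]. destruct (x_to_0 1 ltac:(lra)) as [T2 HT2].
  set (T := Rmax 0 (Rmax T1 T2)).
  assert (HT : 0 <= T /\ T1 <= T /\ T2 <= T).
  { unfold T. pose proof (Rmax_l 0 (Rmax T1 T2)). pose proof (Rmax_r 0 (Rmax T1 T2)).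
    pose proof (Rmax_l T1 T2). pose proof (Rmax_r T1 T2). lra. }
  (* From [T] on the logarithmic derivative of the gap is at most -1, so the gap times exp(t) no
     longer increases. *)
  assert (Hd : forall t, T <= t -> (z t - y t) * exp (1 * t) <= (z T - y T) * exp (1 * T)).
  { intros t Ht. apply (nonincreasing_of_derive (fun t => (z t - y t) * exp (1 * t))
      (fun t => (1 - kap t * gap_rate (x t) (y t) (z t)) * ((z t - y t) * exp (1 * t))) T t Ht).
    - apply cont_mult; [cont_auto|apply cont_exp_linear].
    - intros s Hs. pose proof (gap_derive s ltac:(lra)) as H. evar_last.
      + apply (is_derive_mult (fun s => z s - y s) (fun s => exp (1 * s)) s);
          [exact H| |intros; apply Rmult_comm].
        instantiate (1 := exp (1 * s)). auto_derive; [trivial|ring].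
      + unfold plus, mult; simpl. ring.
    - intros s Hs. signs s. specialize (HT1 s ltac:(lra)). specialize (HT2 s ltac:(lra)).
      rewrite Rminus_0_r, Rabs_right in HT2 by lra.
      pose proof (gap_rate_ge (x s) (y s) (z s) ltac:(lra) ltac:(lra) ltac:(lra)) as G.
      apply (Rmult_le_compat_l (kap s)) in G; [|lra].
      replace (kap s * (6 * (x s ^ 2 * y s ^ 2 * z s ^ 2)))
        with (6 * kap s * (x s ^ 2 * y s ^ 2 * z s ^ 2)) in G by ring.
      rewrite kap_eq, undamped in G by lra.
      pose proof (exp_pos (1 * s)).
      assert (0 <= (z s - y s) * exp (1 * s)) by (apply Rmult_le_pos; lra). nra. }
  set (A := (z T - y T) * exp (1 * T)) in *.
  (* The crude inequality t < exp(t) is enough: for t >= A / eps the gap is at most A exp(-t) <= eps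
     t exp(-t) < eps. *)
  intros eps Heps. exists (Rmax T (A / eps)). intros t Ht.
  pose proof (Rmax_l T (A / eps)). pose proof (Rmax_r T (A / eps)).
  specialize (Hd t ltac:(lra)). pose proof (y_le_z t ltac:(lra)).
  rewrite Rminus_0_r, Rabs_right by lra.
  assert (A <= eps * t).
  { replace A with (eps * (A / eps)) by (field; lra). apply Rmult_le_compat_l; lra. }
  assert (t < exp (1 * t)).
  { rewrite Rmult_1_l. pose proof (exp_ineq1_le t). lra. }
  apply (Rmult_lt_reg_r (exp (1 * t))); [apply exp_pos|]. nra.
Qed.

End Estimates.

(** * Truncation and global existence *)

Inductive coord : Set := G0 | G1 | G2 | G3.

(** A scalar form of [regular_field] closed under ring operations, so that regularity of a
    polynomial field can be read off its syntax. *)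
Definition tame (G : R -> (coord -> R) -> R) : Prop :=
  (forall u : R -> coord -> R, (forall j, cont (fun s => u s j)) -> cont (fun s => G s (u s))) /\
  forall T, exists B L, 0 <= B /\ 0 <= L /\ forall t, 0 <= t <= T ->
    forall u, Rabs (G t u) <= B /\
    forall v M, (forall j, Rabs (u j - v j) <= M) -> Rabs (G t u - G t v) <= L * M.

Lemma tame_const (c : R) : tame (fun _ _ => c).
Proof.
  split; [intros; apply cont_const|]. intros T. exists (Rabs c), 0.
  split; [apply Rabs_pos|]. split; [lra|]. intros t _ u. split; [lra|].
  intros v M _. rewrite Rminus_diag, Rabs_R0. lra.
Qed.

Lemma tame_plus (G H : R -> (coord -> R) -> R) :
  tame G -> tame H -> tame (fun t u => G t u + H t u).
Proof.
  intros [CG LG] [CH LH]. split; [intros u Hu; apply cont_plus; auto|].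
  intros T. destruct (LG T) as [B1 [L1 [HB1 [HL1 E1]]]]. destruct (LH T) as [B2 [L2 [HB2 [HL2 E2]]]].
  exists (B1 + B2), (L1 + L2). split; [lra|]. split; [lra|]. intros t Ht u.
  destruct (E1 t Ht u) as [A1 D1]. destruct (E2 t Ht u) as [A2 D2]. split.
  - eapply Rle_trans; [apply Rabs_triang|lra].
  - intros v M HM. specialize (D1 v M HM). specialize (D2 v M HM).
    replace (G t u + H t u - (G t v + H t v)) with ((G t u - G t v) + (H t u - H t v)) by ring.
    eapply Rle_trans; [apply Rabs_triang|lra].
Qed.

(** The product is Lipschitz because each factor is also bounded; this is why [tame] records a bound
    beside the Lipschitz constant. *)
Lemma tame_mult (G H : R -> (coord -> R) -> R) :
  tame G -> tame H -> tame (fun t u => G t u * H t u).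
Proof.
  intros [CG LG] [CH LH]. split; [intros u Hu; apply cont_mult; auto|].
  intros T. destruct (LG T) as [B1 [L1 [HB1 [HL1 E1]]]]. destruct (LH T) as [B2 [L2 [HB2 [HL2 E2]]]].
  exists (B1 * B2), (B2 * L1 + B1 * L2). split; [nra|]. split; [nra|]. intros t Ht u.
  destruct (E1 t Ht u) as [A1 D1]. destruct (E2 t Ht u) as [A2 D2]. split.
  - rewrite Rabs_mult. apply Rmult_le_compat; auto using Rabs_pos.
  - intros v M HM. specialize (D1 v M HM). specialize (D2 v M HM).
    destruct (E1 t Ht v) as [A1' _].
    replace (G t u * H t u - G t v * H t v)
      with (H t u * (G t u - G t v) + G t v * (H t u - H t v)) by ring.
    eapply Rle_trans; [apply Rabs_triang|]. rewrite !Rabs_mult.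
    replace ((B2 * L1 + B1 * L2) * M) with (B2 * (L1 * M) + B1 * (L2 * M)) by ring.
    apply Rplus_le_compat; apply Rmult_le_compat; auto using Rabs_pos.
Qed.

Lemma tame_opp (G : R -> (coord -> R) -> R) : tame G -> tame (fun t u => - G t u).
Proof.
  intros [CG LG]. split; [intros u Hu; apply cont_opp; auto|].
  intros T. destruct (LG T) as [B [L [HB [HL E]]]].
  exists B, L. split; [exact HB|]. split; [exact HL|]. intros t Ht u.
  destruct (E t Ht u) as [A D]. split; [rewrite Rabs_Ropp; exact A|].
  intros v M HM. replace (- G t u - - G t v) with (- (G t u - G t v)) by ring.
  rewrite Rabs_Ropp. auto.
Qed.

Lemma tame_minus (G H : R -> (coord -> R) -> R) :
  tame G -> tame H -> tame (fun t u => G t u - H t u).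
Proof. intros HG HH. apply (tame_plus G (fun t u => - H t u)); [|apply tame_opp]; assumption. Qed.

Lemma tame_pow (G : R -> (coord -> R) -> R) (n : nat) : tame G -> tame (fun t u => G t u ^ n).
Proof.
  intros HG. induction n as [|n IH]; [exact (tame_const 1)|].
  apply (tame_mult G (fun t u => G t u ^ n)); assumption.
Qed.

(** Treats [clamp] and [cutoff] at once: both are nonexpansive in the coordinate and bounded in
    terms of the radius, which is itself bounded on [0, T]. *)
Lemma tame_coord (phi : R -> R -> R) (N : R -> R) (j : coord) :
  cont N -> (forall f, cont f -> cont (fun s => phi (N s) (f s))) ->
  (forall K a, Rabs (phi K a) <= Rabs K + 1) ->
  (forall K a a', Rabs (phi K a - phi K a') <= Rabs (a - a')) ->
  tame (fun t u => phi (N t) (u j)).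
Proof.
  intros HN HC HB HL. split; [intros u Hu; apply (HC (fun s => u s j)), Hu|].
  intros T. destruct (cont_bounded N 0 T HN) as [B [HB0 HB1]].
  exists (B + 1), 1. split; [lra|]. split; [lra|]. intros t Ht u. split.
  - specialize (HB1 t Ht). specialize (HB (N t) (u j)). lra.
  - intros v M HM. rewrite Rmult_1_l. eapply Rle_trans; [apply HL|apply HM].
Qed.

Lemma regular_field_of_tame (F : R -> (coord -> R) -> coord -> R) :
  (forall i, tame (fun t u => F t u i)) -> regular_field F.
Proof.
  intros HF. split; [intros u Hu i; apply (HF i), Hu|]. intros T.
  destruct (HF G0) as [_ L0], (HF G1) as [_ L1], (HF G2) as [_ L2], (HF G3) as [_ L3].
  destruct (L0 T) as [b0 [l0 [P0 [Q0 E0]]]]. destruct (L1 T) as [b1 [l1 [P1 [Q1 E1]]]].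
  destruct (L2 T) as [b2 [l2 [P2 [Q2 E2]]]]. destruct (L3 T) as [b3 [l3 [P3 [Q3 E3]]]].
  exists (b0 + b1 + b2 + b3), (l0 + l1 + l2 + l3). split; [lra|]. split; [lra|].
  intros t Ht i u.
  assert (W : exists c l, 0 <= l /\ c <= b0 + b1 + b2 + b3 /\ l <= l0 + l1 + l2 + l3 /\
    Rabs (F t u i) <= c /\ forall v M, (forall j, Rabs (u j - v j) <= M) ->
    Rabs (F t u i - F t v i) <= l * M).
  { destruct i; [exists b0, l0; specialize (E0 t Ht u)|exists b1, l1; specialize (E1 t Ht u)
      |exists b2, l2; specialize (E2 t Ht u)|exists b3, l3; specialize (E3 t Ht u)];
      repeat split; try lra; tauto. }
  destruct W as [c [l [Hl0 [Hc [Hl [A D]]]]]]. split; [lra|].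
  intros v M HM. specialize (D v M HM).
  assert (0 <= M) by (eapply Rle_trans; [apply Rabs_pos|apply (HM G0)]). nra.
Qed.

(** Clamp and cutoff share the margin between N and N + 1: the cutoff falls from 1 to 0 across it,
    while the clamp is still the identity there. *)
Definition clamp (N a : R) : R := Rmax (- (N + 1)) (Rmin (N + 1) a).
Definition cutoff (N a : R) : R := Rmax 0 (Rmin 1 (N + 1 - Rabs a)).

Lemma tame_clamp (N : R -> R) (j : coord) : cont N -> tame (fun t u => clamp (N t) (u j)).
Proof.
  intros HN. apply (tame_coord clamp N j HN).
  - intros f Hf. apply cont_Rmax; [cont_auto|]. apply cont_Rmin; cont_auto.
  - intros K a. unfold clamp, Rmax, Rmin, Rabs.
    repeat destruct Rle_dec; repeat destruct Rcase_abs; lra.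
  - intros K a a'. unfold clamp, Rmax, Rmin, Rabs.
    repeat destruct Rle_dec; repeat destruct Rcase_abs; lra.
Qed.

Lemma tame_cutoff (N : R -> R) (j : coord) : cont N -> tame (fun t u => cutoff (N t) (u j)).
Proof.
  intros HN. apply (tame_coord cutoff N j HN).
  - intros f Hf. apply cont_Rmax; [cont_auto|]. apply cont_Rmin; [cont_auto|].
    apply cont_minus; [cont_auto|apply cont_Rabs, Hf].
  - intros K a. pose proof (Rabs_pos K). unfold cutoff, Rmax, Rmin.
    repeat destruct Rle_dec; rewrite Rabs_right; lra.
  - intros K a a'. unfold cutoff, Rmax, Rmin, Rabs.
    repeat destruct Rle_dec; repeat destruct Rcase_abs; lra.
Qed.

Lemma cutoff_range (N a : R) : 0 <= cutoff N a <= 1.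
Proof. unfold cutoff, Rmax, Rmin. repeat destruct Rle_dec; lra. Qed.

Lemma cutoff_1 (N a : R) : Rabs a <= N -> cutoff N a = 1.
Proof. intros H. unfold cutoff, Rmax, Rmin. repeat destruct Rle_dec; lra. Qed.

Lemma cutoff_0_or_clamp (N a : R) : cutoff N a = 0 \/ clamp N a = a.
Proof.
  unfold cutoff, clamp. destruct (Rle_dec (Rabs a) (N + 1)) as [H|H].
  - right. apply Rabs_le_between in H. rewrite Rmin_right, Rmax_right; lra.
  - left. rewrite Rmin_right, Rmax_left; lra.
Qed.

Definition cutoffs (N : R) (u : coord -> R) : R :=
  cutoff N (u G0) * cutoff N (u G1) * cutoff N (u G2) * cutoff N (u G3).

Lemma cutoffs_range (N : R) (u : coord -> R) : 0 <= cutoffs N u <= 1.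
Proof.
  unfold cutoffs. pose proof (cutoff_range N (u G0)). pose proof (cutoff_range N (u G1)).
  pose proof (cutoff_range N (u G2)). pose proof (cutoff_range N (u G3)).
  assert (0 <= cutoff N (u G0) * cutoff N (u G1) <= 1) by nra.
  assert (0 <= cutoff N (u G0) * cutoff N (u G1) * cutoff N (u G2) <= 1) by nra. nra.
Qed.

Definition SL_field (b : R) (u : coord -> R) (i : coord) : R :=
  match i with
  | G0 => - (b * u G0 ^ 2 * p_poly (- u G1) (u G2) (u G3)) * u G0
  | G1 => - (b * u G0 ^ 2 * q_poly (- u G1) (u G2) (u G3)) * u G1
  | G2 => - (b * u G0 ^ 2 * q_poly (u G2) (- u G1) (u G3)) * u G2
  | G3 => - (b * u G0 ^ 2 * q_poly (u G3) (- u G1) (u G2)) * u G3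
  end.

(* The clamp makes the field globally Lipschitz on bounded times; where it acts the cutoff
   vanishes, so the truncated field is a nonnegative multiple of the original one. *)
Definition truncated_field (b : R) (N : R -> R) (t : R) (u : coord -> R) (i : coord) : R :=
  cutoffs (N t) u * SL_field b (fun j => clamp (N t) (u j)) i.

Ltac tame_auto :=
  lazymatch goal with
  | |- tame (fun _ _ => ?c) => apply (tame_const c)
  | |- tame (fun t u => clamp _ (u _)) => apply tame_clamp; assumption
  | |- tame (fun t u => cutoff _ (u _)) => apply tame_cutoff; assumption
  | |- tame (fun t u => @?f t u + @?g t u) => apply (tame_plus f g); tame_auto
  | |- tame (fun t u => @?f t u - @?g t u) => apply (tame_minus f g); tame_auto
  | |- tame (fun t u => @?f t u * @?g t u) => apply (tame_mult f g); tame_auto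
  | |- tame (fun t u => - @?f t u) => apply (tame_opp f); tame_auto
  | |- tame (fun t u => @?f t u ^ ?n) => apply (tame_pow f n); tame_auto
  end.

Lemma truncated_field_regular (b : R) (N : R -> R) : cont N -> regular_field (truncated_field b N).
Proof.
  intros HN. apply regular_field_of_tame.
  intros []; unfold truncated_field, cutoffs, SL_field, p_poly, q_poly;
    cbv beta iota; tame_auto.
Qed.

(** Exhibits the truncated system as a damped one with [chi] equal to the product of the cutoffs. *)
Lemma truncated_field_eq (b : R) (N : R -> R) (t : R) (u : coord -> R) (i : coord) :
  truncated_field b N t u i = cutoffs (N t) u * SL_field b u i.
Proof.
  unfold truncated_field.
  assert (H : cutoffs (N t) u = 0 \/ forall j, clamp (N t) (u j) = u j).
  { unfold cutoffs. destruct (cutoff_0_or_clamp (N t) (u G0)) as [->|E0]; [left; ring|].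
    destruct (cutoff_0_or_clamp (N t) (u G1)) as [->|E1]; [left; ring|].
    destruct (cutoff_0_or_clamp (N t) (u G2)) as [->|E2]; [left; ring|].
    destruct (cutoff_0_or_clamp (N t) (u G3)) as [->|E3]; [left; ring|].
    right. intros []; assumption. }
  destruct H as [->|H]; [ring|]. destruct i; simpl; rewrite !H; reflexivity.
Qed.

Lemma beta_of_eq (h0 h1 h2 h3 : R) : 0 < h0 -> 0 < h1 -> 0 < h2 -> 0 < h3 ->
  6 * beta_of h0 h1 h2 h3 * (h0 * h1 * h2 * h3) ^ 2 = 1.
Proof. intros. unfold beta_of. field. lra. Qed.

Lemma right_cont_of_cont (f : R -> R) : cont f -> right_cont_at0 f.
Proof.
  intros Hf eps Heps. destruct (cont_pt f 0 Hf eps Heps) as [d [Hd H]].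
  exists d. split; [exact Hd|]. intros t Ht.
  destruct (Req_dec t 0) as [->|Hne]; [rewrite Rminus_diag, Rabs_R0; lra|].
  apply H. split; [split; [exact I|lra]|].
  unfold dist; simpl. unfold Rdist. rewrite Rminus_0_r, Rabs_right; lra.
Qed.

(** The truncated system has a global solution, to which the a priori estimates apply. By [box] the
    cutoffs equal 1 along it at all times t >= 0, so it solves (SL) itself and no continuation
    argument is involved. *)
Lemma SL_exists_ordered (h0 h1 h2 h3 : R) :
  0 < h0 -> 0 < h1 -> 0 < h2 -> h2 <= h3 ->
  exists g0 g1 g2 g3 : R -> R, SL_solution h0 h1 h2 h3 g0 g1 g2 g3.
Proof.
  intros H0 H1 H2 H3. set (b := beta_of h0 h1 h2 h3). set (N := box_radius h0 h1 h2 h3).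
  assert (HN : cont N).
  { apply cont_plus; [apply cont_const|]. apply cont_mult; [apply cont_const|].
    apply cont_exp_linear. }
  destruct (global_picard_lindelof (truncated_field b N)
    (fun i => match i with G0 => h0 | G1 => h1 | G2 => h2 | G3 => h3 end)
    (truncated_field_regular b N HN)) as [u [Hi [Hc Hd]]].
  assert (S : damped_SL b (fun t => cutoffs (N t) (u t)) (fun t => u t G0) (fun t => u t G1)
    (fun t => u t G2) (fun t => u t G3) h0 h1 h2 h3).
  { split; [rewrite !Hi; auto|]. split; [auto|]. intros t Ht. split; [apply cutoffs_range|].
    assert (D : forall i, is_derive (fun s => u s i) t (cutoffs (N t) (u t) * SL_field b (u t) i)).
    { intros i. rewrite <- truncated_field_eq. apply Hd, Ht. }
    split; [|split; [|split]];
      [evar_last; [apply (D G0)|]|evar_last; [apply (D G1)|]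
      |evar_last; [apply (D G2)|]|evar_last; [apply (D G3)|]]; unfold SL_field; ring. }
  pose proof (beta_of_eq h0 h1 h2 h3 H0 H1 H2 ltac:(lra)) as Hb.
  assert (E : forall t, 0 <= t -> cutoffs (N t) (u t) = 1).
  { intros t Ht. destruct (box _ _ _ _ _ _ _ _ _ _ H0 H1 H2 H3 Hb S t Ht) as [B0 [B1 [B2 B3]]].
    unfold cutoffs. rewrite !cutoff_1 by assumption. ring. }
  exists (fun t => u t G0), (fun t => u t G1), (fun t => u t G2), (fun t => u t G3).
  unfold SL_solution. rewrite !Hi. do 4 (split; [reflexivity|]).
  do 4 (split; [apply right_cont_of_cont, Hc|]). intros t Ht.
  destruct S as [_ [_ S]]. destruct (S t Ht) as [_ [d0 [d1 [d2 d3]]]].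
  rewrite E in d0, d1, d2, d3 by lra.
  split; [|split; [|split]]; apply is_derive_Reals;
    [evar_last; [exact d0|]|evar_last; [exact d1|]
      |evar_last; [exact d2|]|evar_last; [exact d3|]]; fold b; ring.
Qed.

(** * Exchange of g22 and g33, extension to negative times, and conclusion *)

Lemma SL_solution_swap (h0 h1 h2 h3 : R) (g0 g1 g2 g3 : R -> R) :
  SL_solution h0 h1 h2 h3 g0 g1 g2 g3 -> SL_solution h0 h1 h3 h2 g0 g1 g3 g2.
Proof.
  unfold SL_solution.
  replace (beta_of h0 h1 h3 h2) with (beta_of h0 h1 h2 h3) by (unfold beta_of; f_equal; ring).
  intros [I0 [I1 [I2 [I3 [R0 [R1 [R2 [R3 D]]]]]]]].
  do 8 (split; [assumption|]). intros t Ht. destruct (D t Ht) as [d0 [d1 [d2 d3]]].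
  (* Both polynomials are symmetric in their last two arguments. *)
  replace (p_poly (- g1 t) (g3 t) (g2 t)) with (p_poly (- g1 t) (g2 t) (g3 t))
    by (unfold p_poly; ring).
  replace (q_poly (- g1 t) (g3 t) (g2 t)) with (q_poly (- g1 t) (g2 t) (g3 t))
    by (unfold q_poly; ring).
  auto.
Qed.

(** A given solution is controlled only for t >= 0. Freezing it at its initial value for negative
    times makes it continuous on the whole line, as the estimates require; right continuity at 0
    joins the two pieces. *)
Lemma cont_extend (g : R -> R) (dg : R -> R) : right_cont_at0 g ->
  (forall t, 0 < t -> is_derive g t (dg t)) -> cont (fun t => g (Rmax t 0)).
Proof.
  intros Hr Hd t. destruct (Rlt_le_dec 0 t) as [Ht|Ht].
  - apply (continuous_comp (fun t => Rmax t 0) g); [apply cont_Rmax_0|].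
    apply (ex_derive_continuous (V := R_NormedModule)). exists (dg (Rmax t 0)).
    apply Hd. rewrite Rmax_left; lra.
  - apply continuity_pt_filterlim. intros eps Heps. destruct (Hr eps Heps) as [d [Hdp H]].
    exists d. split; [exact Hdp|]. intros s [_ Hs]. unfold dist in *; simpl in *.
    unfold Rdist in *. rewrite (Rmax_right t 0) by lra. apply H.
    apply Rabs_def2 in Hs. split; [apply Rmax_r|]. apply Rmax_lub_lt; lra.
Qed.

Lemma is_derive_extend (g : R -> R) (t l : R) : 0 < t -> is_derive g t l ->
  is_derive (fun s => g (Rmax s 0)) t l.
Proof.
  intros Ht. apply is_derive_ext_loc. exists (mkposreal t Ht). intros s Hs.
  unfold ball in Hs; simpl in Hs. unfold AbsRing_ball, abs, minus, plus, opp in Hs.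
  simpl in Hs. apply Rabs_def2 in Hs. rewrite Rmax_left; [reflexivity|lra].
Qed.

Lemma damped_SL_of_SL (h0 h1 h2 h3 : R) (g0 g1 g2 g3 : R -> R) :
  SL_solution h0 h1 h2 h3 g0 g1 g2 g3 ->
  damped_SL (beta_of h0 h1 h2 h3) (fun _ => 1) (fun t => g0 (Rmax t 0)) (fun t => g1 (Rmax t 0))
    (fun t => g2 (Rmax t 0)) (fun t => g3 (Rmax t 0)) h0 h1 h2 h3.
Proof.
  unfold SL_solution. intros [I0 [I1 [I2 [I3 [R0 [R1 [R2 [R3 D]]]]]]]].
  split; [rewrite Rmax_left by lra; auto|]. split.
  - split; [|split; [|split]]; (eapply cont_extend; [assumption|]);
      intros t Ht; apply is_derive_Reals, (D t Ht).
  - intros t Ht. destruct (D t Ht) as [d0 [d1 [d2 d3]]]. rewrite !Rmax_left by lra.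
    split; [lra|].
    split; [|split; [|split]]; (apply is_derive_extend; [exact Ht|]); apply is_derive_Reals;
      [eapply eq_ind; [exact d0|ring]|eapply eq_ind; [exact d1|ring]
      |eapply eq_ind; [exact d2|ring]|eapply eq_ind; [exact d3|ring]].
Qed.

Lemma tends_to_at_infty_ext (f g : R -> R) (l : R) :
  (forall t, 0 <= t -> f t = g t) -> tends_to_at_infty f l -> tends_to_at_infty g l.
Proof.
  intros E H eps Heps. destruct (H eps Heps) as [T HT]. exists (Rmax 0 T). intros t Ht.
  pose proof (Rmax_l 0 T). pose proof (Rmax_r 0 T). rewrite <- E by lra. apply HT. lra.
Qed.

Lemma tends_to_pinfty_ext (f g : R -> R) :
  (forall t, 0 <= t -> f t = g t) -> tends_to_pinfty f -> tends_to_pinfty g.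
Proof.
  intros E H M. destruct (H M) as [T HT]. exists (Rmax 0 T). intros t Ht.
  pose proof (Rmax_l 0 T). pose proof (Rmax_r 0 T). rewrite <- E by lra. apply HT. lra.
Qed.

Lemma SL_asymptotics_ordered (h0 h1 h2 h3 : R) (g0 g1 g2 g3 : R -> R) :
  0 < h0 -> 0 < h1 -> 0 < h2 -> h2 <= h3 -> SL_solution h0 h1 h2 h3 g0 g1 g2 g3 ->
  tends_to_at_infty g0 0 /\ tends_to_at_infty g1 0 /\ tends_to_pinfty g2 /\
  tends_to_pinfty g3 /\ tends_to_at_infty (fun t => g3 t - g2 t) 0.
Proof.
  intros H0 H1 H2 H3 S. apply damped_SL_of_SL in S.
  pose proof (beta_of_eq h0 h1 h2 h3 H0 H1 H2 ltac:(lra)) as Hb.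
  assert (E : forall (g : R -> R) t, 0 <= t -> g (Rmax t 0) = g t)
    by (intros g t Ht; rewrite Rmax_left; [reflexivity|lra]).
  assert (U : forall t, 0 < t -> (fun _ : R => 1) t = 1) by reflexivity.
  split; [|split; [|split; [|split]]].
  - apply (tends_to_at_infty_ext _ _ _ (E g0)). exact (g0_to_0 _ _ _ _ _ _ _ _ _ _ H0 H1 H2 H3 Hb S U).
  - apply (tends_to_at_infty_ext _ _ _ (E g1)). exact (x_to_0 _ _ _ _ _ _ _ _ _ _ H0 H1 H2 H3 Hb S U).
  - apply (tends_to_pinfty_ext _ _ (E g2)). exact (y_infty _ _ _ _ _ _ _ _ _ _ H0 H1 H2 H3 Hb S U).
  - apply (tends_to_pinfty_ext _ _ (E g3)). exact (z_infty _ _ _ _ _ _ _ _ _ _ H0 H1 H2 H3 Hb S U).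
  - apply (tends_to_at_infty_ext _ _ _ (E (fun t => g3 t - g2 t))).
    exact (gap_to_0 _ _ _ _ _ _ _ _ _ _ H0 H1 H2 H3 Hb S U).
Qed.

Theorem theorem5p8 (h0 h1 h2 h3 : R) :
  0 < h0 -> 0 < h1 -> 0 < h2 -> 0 < h3 ->
  (exists g0 g1 g2 g3 : R -> R, SL_solution h0 h1 h2 h3 g0 g1 g2 g3) /\
  (forall g0 g1 g2 g3 : R -> R, SL_solution h0 h1 h2 h3 g0 g1 g2 g3 ->
     tends_to_at_infty g0 0 /\ tends_to_at_infty g1 0 /\
     tends_to_pinfty g2 /\ tends_to_pinfty g3 /\
     tends_to_at_infty (fun t => g3 t - g2 t) 0).
Proof.
  intros H0 H1 H2 H3. destruct (Rle_dec h2 h3) as [H|H].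
  - split; [apply SL_exists_ordered; assumption|].
    intros g0 g1 g2 g3. apply SL_asymptotics_ordered; assumption.
  - split.
    + destruct (SL_exists_ordered h0 h1 h3 h2 H0 H1 H3 ltac:(lra)) as [g0 [g1 [g3 [g2 S]]]].
      exists g0, g1, g2, g3. apply SL_solution_swap, S.
    + intros g0 g1 g2 g3 S. apply SL_solution_swap in S.
      destruct (SL_asymptotics_ordered h0 h1 h3 h2 g0 g1 g3 g2 H0 H1 H3 ltac:(lra) S)
        as [A0 [A1 [A3 [A2 G]]]].
      do 4 (split; [assumption|]). intros eps Heps. destruct (G eps Heps) as [T HT].
      exists T. intros t Ht. rewrite Rminus_0_r, Rabs_minus_sym, <- (Rminus_0_r (g2 t - g3 t)).
      apply HT, Ht.
Qed.
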